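(* Let $P_n$ be the path with $n$ edges and $n+1$ vertices. Then the graphicahedron $\mathcal{P}_{P_n}$ is isomorphic (as a poset) to the face lattice of the permutahedron $\Pi_n$, the $n$-dimensional convex polytope in $\mathbb{R}^{n+1}$ given as the convex hull of all points obtained from $(1,2,\dots,n+1)$ by permuting coordinates.
   Context: For a graph $G$ with vertex set $\{1,\dots,p\}$ and an edge $e=\{i,j\}$ let $\tau_e=(i\;j)\in S_p$, and for $K\subseteq E(G)$ let $T_K=\langle \tau_e : e\in K\rangle$ (trivial if $K=\emptyset$). The graphicahedron $\mathcal{P}_G$ is the poset of pairs $(K,\alpha)$, $K\subseteq E(G)$, $\alpha\in S_p$, modulo $(K,\alpha)\sim(L,\beta)$ iff $K=L$ and $T_K\alpha=T_L\beta$, ordered by $(K,\alpha)\le(L,\beta)$ iff $K\subseteq L$ and $T_K\alpha\subseteq T_L\beta$, ranked by $|K|$, with an adjoined least element of rank $-1$. The face lattice of a convex polytope includes the empty face and the polytope itself. *)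

(* Defs.v *)
From HB Require Import structures.
From mathcomp Require Import all_boot all_order all_fingroup all_algebra.
From mathcomp Require Import generic_quotient.
From mathcomp Require Import boolp classical_sets reals convex.

Set Implicit Arguments.
Unset Strict Implicit.
Unset Printing Implicit Defensive.

Import Order.TTheory GRing.Theory Num.Theory.

Definition poset_isomorphic (d d' : Order.disp_t)
    (P : porderType d) (Q : porderType d') : Prop :=
  exists f : P -> Q,
    bijective f /\ forall x y : P, (f x <= f y)%O = (x <= y)%O.

(* The vertices 1, ..., p are encoded as 0, ..., p - 1. *)
Record sgraph (p : nat) := SGraph {
  adj : rel 'I_p;
  adj_sym : symmetric adj;
  adj_irr : irreflexive adj }.

Definition edge_set (p : nat) (G : sgraph p) : {set {set 'I_p}} :=
  [set [set i; j] | i in 'I_p, j in 'I_p & adj G i j].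

Definition edge (p : nat) (G : sgraph p) : Type :=
  {e : {set 'I_p} | e \in edge_set G}.

Section Graphicahedron.
Context (p : nat) (G : sgraph p).
Local Open Scope group_scope.

(* [tau e] only depends on the unordered pair [e], see [tauE]. *)
Definition tau (e : edge G) : 'S_p :=
  if enum (val e) is [:: i; j] then tperm i j else 1.

Lemma tauE (e : edge G) (i j : 'I_p) :
  i != j -> val e = [set i; j] -> tau e = tperm i j.
Proof.
move=> ij eE; rewrite /tau eE.
have : perm_eq (enum [set i; j]) [:: i; j].
  apply: uniq_perm; rewrite ?enum_uniq //= ?inE ?ij // => k.
  by rewrite mem_enum !inE.
move=> pe; have := perm_size pe; case: (enum _) pe => [|x [|y [|]]] //= pe _.
have := perm_uniq pe; rewrite /= !inE ij !andbT => xy.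
have := perm_mem pe i; have := perm_mem pe j; rewrite !inE !eqxx ?orbT /=.
move=> /orP[] /eqP jE /orP[] /eqP iE; subst; rewrite ?eqxx // in ij *.
exact: tpermC.
Qed.

Definition T (K : {set edge G}) : {group 'S_p} := <<[set tau e | e in K]>>%G.

Definition gpair : Type := ({set edge G} * 'S_p)%type.

Definition gsim : rel gpair :=
  fun x y => (x.1 == y.1) && (T x.1 :* x.2 == T y.1 :* y.2).

Lemma gsim_refl : reflexive gsim.
Proof. by move=> x; rewrite /gsim !eqxx. Qed.

Lemma gsim_sym : symmetric gsim.
Proof. by move=> x y; rewrite /gsim eq_sym [X in _ && X]eq_sym. Qed.

Lemma gsim_trans : transitive gsim.
Proof.
move=> y x z /andP[/eqP xy /eqP cxy] /andP[/eqP yz /eqP cyz].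
by apply/andP; split; [rewrite xy yz | rewrite cxy cyz].
Qed.

Canonical gsim_equiv := EquivRel gsim gsim_refl gsim_sym gsim_trans.

Definition gclass : Type := {eq_quot gsim_equiv}%qT.

Definition gpair_le : rel gpair :=
  fun x y => (x.1 \subset y.1) && (T x.1 :* x.2 \subset T y.1 :* y.2).

Definition gclass_le : rel gclass := lift_fun2 gclass gpair_le.

Lemma gclass_leE (x y : gpair) :
  gclass_le (\pi_gclass x)%qT (\pi_gclass y)%qT = gpair_le x y.
Proof.
rewrite /gclass_le -lock.
have repr_pi z : gsim (repr (\pi_gclass z)%qT) z by apply/eqmodP; rewrite reprK.
have /andP[/eqP x1 /eqP x2] := repr_pi x.
have /andP[/eqP y1 /eqP y2] := repr_pi y.
by rewrite /gpair_le x2 y2 x1 y1.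
Qed.

Lemma gclass_le_refl : reflexive gclass_le.
Proof.
by move=> a; rewrite -[a]reprK gclass_leE /gpair_le !subxx.
Qed.

Lemma gclass_le_anti : antisymmetric gclass_le.
Proof.
move=> a b; rewrite -[a]reprK -[b]reprK !gclass_leE /gpair_le.
move=> /andP[/andP[K1 C1] /andP[K2 C2]]; apply/eqmodP.
by rewrite /= /gsim !finset.eqEsubset K1 K2 C1 C2.
Qed.

Lemma gclass_le_trans : transitive gclass_le.
Proof.
move=> b a c; rewrite -[a]reprK -[b]reprK -[c]reprK !gclass_leE /gpair_le.
by move=> /andP[K1 C1] /andP[K2 C2]; rewrite (fintype.subset_trans K1) ?(fintype.subset_trans C1).
Qed.

(* [None] is the adjoined least element. *)
Definition graphicahedron : Type := option gclass.
HB.instance Definition _ := Choice.on graphicahedron.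

Definition graphicahedron_le : rel graphicahedron := fun a b =>
  match a, b with
  | None, _ => true
  | Some _, None => false
  | Some x, Some y => gclass_le x y
  end.

Lemma graphicahedron_le_refl : reflexive graphicahedron_le.
Proof. by case=> //= a; exact: gclass_le_refl. Qed.

Lemma graphicahedron_le_anti : antisymmetric graphicahedron_le.
Proof. by move=> [a|] [b|] //= /gclass_le_anti ->. Qed.

Lemma graphicahedron_le_trans : transitive graphicahedron_le.
Proof. by move=> [b|] [a|] [c|] //=; exact: gclass_le_trans. Qed.

Fact graphicahedron_display : Order.disp_t. Proof. exact: Order.Disp tt tt. Qed.

HB.instance Definition _ := Order.Le_isPOrder.Build graphicahedron_display
  graphicahedron graphicahedron_le_refl graphicahedron_le_anti
  graphicahedron_le_trans.

End Graphicahedron.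

Definition path_adj (n : nat) : rel 'I_n.+1 :=
  fun i j => (i.+1 == j :> nat) || (j.+1 == i :> nat).

Lemma path_adj_sym (n : nat) : symmetric (@path_adj n).
Proof. by move=> i j; rewrite /path_adj orbC. Qed.

Lemma path_adj_irr (n : nat) : irreflexive (@path_adj n).
Proof. by move=> i; rewrite /path_adj orbb gtn_eqF. Qed.

Definition path_graph (n : nat) : sgraph n.+1 :=
  SGraph (@path_adj_sym n) (@path_adj_irr n).

Local Open Scope classical_set_scope.
Local Open Scope ring_scope.

Definition convex_hull (R : realType) (m : nat) (A : set 'rV[R]_m) :
  set 'rV[R]_m := smallest (@convex_set R 'rV[R]_m) A.

(* The intersections of [P] with the hyperplanes bounding a closed half-space
   that contains [P]. Taking [c = 0] is allowed: [b = 0] then gives [P] itself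
   and [b = 1] gives the empty face. *)
Definition is_face (R : realType) (m : nat) (P F : set 'rV[R]_m) : Prop :=
  exists (c : 'rV[R]_m) (b : R),
    (forall x, P x -> \sum_(i < m) c 0 i * x 0 i <= b) /\
    F = P `&` [set x | \sum_(i < m) c 0 i * x 0 i = b].

(* Ordered by inclusion, the order of MathComp-Analysis on [set _]. *)
Record face_lattice (R : realType) (m : nat) (P : set 'rV[R]_m) := Face {
  face_set :> set 'rV[R]_m;
  _ : face_set \in [set F | is_face P F] }.

Fact face_display : Order.disp_t. Proof. exact: Order.Disp tt tt. Qed.

HB.instance Definition _ (R : realType) (m : nat) (P : set 'rV[R]_m) :=
  [isSub for @face_set R m P].
HB.instance Definition _ (R : realType) (m : nat) (P : set 'rV[R]_m) :=
  [Choice of face_lattice P by <:].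
HB.instance Definition _ (R : realType) (m : nat) (P : set 'rV[R]_m) :=
  [SubChoice_isSubPOrder of face_lattice P by <: with face_display].

Lemma face_latticeP (R : realType) (m : nat) (P : set 'rV[R]_m)
  (F : face_lattice P) : is_face P F.
Proof. by have := valP F; rewrite inE. Qed.

Lemma face_lattice_leE (R : realType) (m : nat) (P : set 'rV[R]_m)
  (F F' : face_lattice P) : (F <= F')%O <-> F `<=` F'.
Proof. by rewrite -Order.le_val subsetEset. Qed.

Definition permutahedron (R : realType) (n : nat) : set 'rV[R]_n.+1 :=
  convex_hull
    [set x | exists s : 'S_n.+1, x = col_perm s (\row_i i.+1%:R)].

(* Main.v *)
(* A linear functional [c] takes at the vertex indexed by [s] the value
   [\sum_i c (s i) * (i + 1)], which by rearrangement is maximal exactly when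
   [c \o s] is nondecreasing. For a maximiser [a], the other maximisers are the
   [t * a] with [t] preserving the level sets of the monotone function
   [c \o a], and these [t] form the group [T K] for [K] the edges on which
   [c \o a] is constant. So the vertex sets of nonempty faces are exactly the
   cosets [T K :* a], and a face is determined by its vertices. *)

Require Import Defs.
From mathcomp Require Import all_boot all_order all_algebra reals.
From mathcomp Require Import all_fingroup generic_quotient.
From mathcomp Require Import boolp classical_sets interval_inference convex.
From mathcomp Require Import ring lra zify.

Set Implicit Arguments.
Unset Strict Implicit.
Unset Printing Implicit Defensive.

Import Order.TTheory GRing.Theory Num.Theory.

(** * Edges of the path and the permutation groups they generate *)

Section PathEdges.
Variable n : nat.
Local Notation G := (path_graph n).

Lemma path_edgeP (e : edge G) :
  exists i j : 'I_n.+1, i.+1 = j :> nat /\ val e = [set i; j]%SET.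
Proof.
case: e => e /=; case/imset2P => i j _; rewrite inE /= => /orP[] /eqP ij ->.
  by exists i, j.
by exists j, i; split=> //; rewrite finset.setUC.
Qed.

Lemma path_edge_exists (i j : 'I_n.+1) :
  i.+1 = j :> nat -> exists e : edge G, val e = [set i; j]%SET.
Proof.
move=> ij; have ije : [set i; j]%SET \in edge_set G.
  by apply/imset2P; exists i j; rewrite // inE /= /path_adj ij eqxx.
by exists (exist (fun e => e \in edge_set G) _ ije).
Qed.

Lemma path_tauE (e : edge G) (i j : 'I_n.+1) :
  i.+1 = j :> nat -> val e = [set i; j]%SET -> tau e = tperm i j.
Proof.
move=> ij; apply: tauE; apply/eqP => /(congr1 val) /= E.
by rewrite E in ij; lia.
Qed.

(** * Permutations preserving the level sets of a monotone function *)

Section Levels.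
Variables (d : Order.disp_t) (X : porderType d) (g : 'I_n.+1 -> X).

Definition level_edges : {set edge G} :=
  [set e : edge G | [forall i in val e, forall j in val e, g i == g j]]%SET.

Definition level_stab : {set 'S_n.+1} :=
  [set t : 'S_n.+1 | [forall i, g (t i) == g i]]%SET.

Lemma level_edgesP (e : edge G) (i j : 'I_n.+1) :
  val e = [set i; j]%SET -> (e \in level_edges) = (g i == g j).
Proof.
move=> eE; rewrite inE eE; apply/idP/eqP => [|gij].
  by move=> /forall_inP/(_ i)/[!(set21, set22)] /(_ isT) /forall_inP/(_ j)
    /[!(set21, set22)] /(_ isT) /eqP.
apply/forall_inP => k /set2P[] ->; apply/forall_inP => l /set2P[] ->;
  by rewrite ?gij.
Qed.

Lemma level_stabP (t : 'S_n.+1) :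
  reflect (forall i, g (t i) = g i) (t \in level_stab).
Proof. by rewrite inE; apply: (iffP forallP) => H i; apply/eqP/H. Qed.

Lemma level_stab_group : group_set level_stab.
Proof.
apply/group_setP; split; first by apply/level_stabP => i; rewrite perm1.
move=> s t /level_stabP sg /level_stabP tg.
by apply/level_stabP => i; rewrite permM tg sg.
Qed.

Lemma tperm_level_stab (i j : 'I_n.+1) : g i = g j -> tperm i j \in level_stab.
Proof. by move=> gij; apply/level_stabP => k; case: tpermP => // ->. Qed.

Hypothesis g_homo : forall i j : 'I_n.+1, (i <= j)%N -> (g i <= g j)%O.

(** Monotonicity makes [g] constant between [i] and [j], so the transposition can be built one edge
    at a time: with [k = j - 1], conjugating [(i k)] by the edge transposition [(k j)] gives
    [(i j)]. *)
Lemma tperm_level_edges (i j : 'I_n.+1) : (i <= j)%N -> g i = g j ->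
  tperm i j \in T level_edges.
Proof.
move: {2}(j - i)%N (erefl (j - i)%N) => m; elim: m j => [|m IH] j jim ij gij.
  have -> : i = j by apply: val_inj => /=; lia.
  by rewrite tperm1 group1.
have kn : (j.-1 < n.+1)%N by have := ltn_ord j; lia.
pose k := Ordinal kn; have kj : k.+1 = j :> nat by rewrite /=; lia.
have gk : g k = g j.
  by apply/le_anti; rewrite g_homo /= -?gij ?g_homo //=; lia.
have [e eE] := path_edge_exists kj.
have tkj : tperm k j \in T level_edges.
  rewrite -(path_tauE kj eE); apply: mem_gen; apply: imset_f.
  by rewrite (level_edgesP eE) gk.
have tik : tperm i k \in T level_edges.
  by apply: IH => /=; [lia|lia|rewrite gk].
have [ik|ik] := eqVneq i k; first by rewrite ik.
have -> : tperm i j = (tperm i k ^ tperm k j)%g.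
  rewrite tpermJ tpermL tpermD // eq_sym //.
  by apply/eqP => E; move: jim; rewrite E; lia.
by rewrite groupJ.
Qed.

(** One inclusion is checked on generators. For the other, multiplying [t] by the transposition of a
    moved point [i] and [t i] stays in the stabiliser and shrinks the support, so induction on the
    support applies. *)
Lemma T_level_edges : T level_edges = level_stab :> {set _}.
Proof.
apply/eqP; rewrite finset.eqEsubset; apply/andP; split.
  rewrite (gen_subG _ (Group level_stab_group)).
  apply/fintype.subsetP => _ /imsetP[e ge ->].
  have [i [j [ij eE]]] := path_edgeP e; rewrite (path_tauE ij eE) /=.
  by apply: tperm_level_stab; apply/eqP; rewrite -(level_edgesP eE).
apply/fintype.subsetP => t.
move: {2}(#|_|) (leqnn #|[set i | t i != i]%SET|) => m.
elim: m t => [|m IH] t tm tg.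
  suff -> : t = 1%g by rewrite group1.
  apply/permP => i; rewrite perm1; apply/eqP.
  move: tm; rewrite leqn0 cards_eq0 => /eqP/setP/(_ i).
  by rewrite !inE => /negbFE.
have [/eqP t1|t1] := boolP (t == 1%g); first by rewrite t1 group1.
have [i ti] : exists i, t i != i.
  apply/existsP; apply: contraNT t1; rewrite negb_exists => /forallP H.
  by apply/eqP/permP => i; rewrite perm1; apply/eqP/negPn.
have gti : g i = g (t i) by rewrite (level_stabP _ tg).
have tpT : tperm i (t i) \in T level_edges.
  case: (leqP i (t i)) => [|/ltnW] le; first exact: tperm_level_edges.
  by rewrite tpermC; apply: tperm_level_edges.
rewrite -[t](mulgK (tperm i (t i))) groupM ?groupV //; apply: IH; last first.
  by have := @groupM _ (Group level_stab_group) t (tperm i (t i)) tg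
       (tperm_level_stab gti).
(* The product fixes [i] and still fixes every fixed point of [t], since neither [i] nor [t i] is
   one. *)
rewrite -ltnS; apply: leq_trans tm; apply: proper_card; apply/properP; split.
  apply/fintype.subsetP => k; rewrite !inE permM; apply: contraNN => /eqP tk.
  rewrite tk tpermD //; first by apply: contraNneq ti => ->; rewrite tk.
  apply: contraNneq ti => H; rewrite -tk in H.
  by move/perm_inj: H => ->; rewrite tk.
by exists i; rewrite !inE // permM tpermR eqxx.
Qed.

End Levels.

(* The level sets of [cuts K] are the components of the path cut down to [K]. *)
Definition cuts (K : {set edge G}) (i : 'I_n.+1) : nat :=
  #|[set e : edge G | (e \notin K) && [forall k in val e, (k <= i)%N]]%SET|.

Lemma cuts_homo K (i j : 'I_n.+1) : (i <= j)%N -> (cuts K i <= cuts K j)%N.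
Proof.
move=> ij; apply/subset_leq_card/fintype.subsetP => e; rewrite !inE.
case/andP=> -> /forall_inP H; apply/forall_inP => k /H ki.
exact: leq_trans ki ij.
Qed.

(** Passing from [i] to [j = i + 1] can add to the count only the edge joining them, and does so
    exactly when that edge is outside [K]. *)
Lemma cuts_level_edges K : level_edges (cuts K) = K.
Proof.
apply/setP => e; have [i [j [ij eE]]] := path_edgeP e.
rewrite (level_edgesP _ eE); apply/eqP/idP => [|eK].
  apply: contra_eqT => eK; rewrite ltn_eqF //.
  apply: proper_card; apply/properP; split.
    apply/fintype.subsetP => f; rewrite !inE => /andP[-> /forall_inP H].
    by apply/forall_inP => k /H; lia.
  exists e; rewrite !inE eK eE /=.
    by apply/forall_inP => k /set2P[] ->; lia.
  by apply/negP => /forall_inP/(_ j); rewrite set22 => /(_ isT); lia.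
apply/eqP; rewrite eqn_leq cuts_homo ?andTb; last by lia.
apply/subset_leq_card/fintype.subsetP => f.
rewrite !inE => /andP[fK /forall_inP H].
rewrite fK /=; have [k [l [kl fE]]] := path_edgeP f.
have lj : (l <= j)%N by apply: H; rewrite fE set22.
have lj' : l != j.
  apply: contraNneq fK => lj'; suff -> : f = e by [].
  apply: val_inj; rewrite fE eE lj'; congr [set _; _]%SET.
  by apply: val_inj => /=; move: kl; rewrite lj'; lia.
have : (l != j :> nat) by [].
by move=> ?; apply/forall_inP => m; rewrite fE => /set2P[] ->; lia.
Qed.

Lemma T_cuts K : T K = level_stab (cuts K) :> {set _}.
Proof.
rewrite -[in T K](cuts_level_edges K).
by apply: T_level_edges => i j; rewrite leEnat; exact: cuts_homo.
Qed.

(** Once both cosets are written with the representative [a], each [tau e] with [e] in [K] lies in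
    [T L]. It then preserves the levels of [cuts L], which forces [e] into [L]. Hence coset
    inclusion alone determines the order on pairs. *)
Lemma rcoset_T_subset (K L : {set edge G}) (a b : 'S_n.+1) :
  (T K :* a \subset T L :* b)%g -> K \subset L.
Proof.
move=> sub; have aL : (a \in T L :* b)%g.
  by apply: (fintype.subsetP sub); apply: rcoset_refl.
rewrite -(rcoset_eqP aL) in sub.
apply/fintype.subsetP => e eK; have [i [j [ij eE]]] := path_edgeP e.
have : tau e \in T L.
  have := fintype.subsetP sub (tau e * a)%g; rewrite !mem_rcoset !mulgK; apply.
  by apply: mem_gen; apply: imset_f.
rewrite T_cuts.
move=> /level_stabP/(_ j); rewrite (path_tauE ij eE) tpermR => /eqP.
by rewrite -(level_edgesP _ eE) cuts_level_edges.
Qed.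

End PathEdges.

(** * The rearrangement inequality and its equality case *)

Section Rearrangement.
Local Open Scope ring_scope.
Variables (R : realDomainType) (p : nat) (c : 'I_p -> R).

Definition rearr_sum (s : 'S_p) : R := \sum_(i < p) c (s i) * i.+1%:R.

(** Exchange argument: swapping the values at an inversion [i < j] strictly increases the sum, by
    [(c (s i) - c (s j)) * (j - i)]. *)
Lemma rearr_sum_max_homo (s : 'S_p) :
  (forall t, rearr_sum t <= rearr_sum s) ->
  forall i j : 'I_p, (i <= j)%N -> c (s i) <= c (s j).
Proof.
move=> smax i j; rewrite leq_eqVlt => /orP[/eqP/val_inj -> //|ij].
rewrite leNgt; apply/negP => cji.
have ij' : j != i by apply/eqP => E; rewrite E ltnn in ij.
have := smax (tperm i j * s)%g; rewrite leNgt => /negP; apply.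
rewrite /rearr_sum !(bigD1 i isT) !(bigD1 j ij') /= !permM tpermL tpermR.
rewrite [X in _ < _ + (_ + X)](eq_bigr (fun k => c (s k) * k.+1%:R));
  last first.
  by move=> k /andP[ki kj]; rewrite permM tpermD // eq_sym.
rewrite !addrA ltrD2r -subr_gt0.
rewrite (_ : _ - _ = (c (s i) - c (s j)) * (j.+1%:R - i.+1%:R)); last by ring.
by rewrite mulr_gt0 // subr_gt0 // ltr_nat.
Qed.

(** Both sequences list the same multiset of values of [c] in sorted order. *)
Lemma homo_rearr_eq (s t : 'S_p) :
  (forall i j : 'I_p, (i <= j)%N -> c (s i) <= c (s j)) ->
  (forall i j : 'I_p, (i <= j)%N -> c (t i) <= c (t j)) ->
  forall i, c (s i) = c (t i).
Proof.
have enumP (u : 'S_p) : perm_eq (map u (enum 'I_p)) (enum 'I_p).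
  apply: uniq_perm; rewrite ?(map_inj_uniq (@perm_inj _ u)) ?enum_uniq //.
  move=> k; rewrite !mem_enum; apply/mapP; exists (u^-1 k)%g.
    by rewrite mem_enum.
  by rewrite permKV.
have srt (u : 'S_p) : (forall i j : 'I_p, (i <= j)%N -> c (u i) <= c (u j)) ->
    sorted <=%R (map c (map u (enum 'I_p))).
  move=> uh; rewrite -map_comp.
  apply: (@homo_sorted _ _ (c \o u) (relpre val leq)) => //.
  by rewrite -sorted_map val_enum_ord iota_sorted.
move=> sh th i.
have : map c (map s (enum 'I_p)) = map c (map t (enum 'I_p)).
  apply: (sorted_eq le_trans le_anti (srt _ sh) (srt _ th)).
  by apply: perm_map; rewrite (perm_trans (enumP s)) // perm_sym enumP.
rewrite -!map_comp => /eq_in_map/(_ i); apply.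
by rewrite -enumT mem_enum.
Qed.

(** A maximiser [u] exists by finiteness; it is monotone, so it takes the same values as [s] and
    gives the same sum. *)
Lemma homo_rearr_sum_max (s t : 'S_p) :
  (forall i j : 'I_p, (i <= j)%N -> c (s i) <= c (s j)) ->
  rearr_sum t <= rearr_sum s.
Proof.
move=> sh; pose u := [arg max_(u > s) rearr_sum u]%O.
have umax v : rearr_sum v <= rearr_sum u.
  by rewrite /u; case: Order.TotalTheory.arg_maxP => // w _; apply.
rewrite (le_trans (umax t)) // le_eqVlt; apply/orP; left; apply/eqP.
apply: eq_bigr => i _; congr (_ * _).
exact: homo_rearr_eq (rearr_sum_max_homo umax) sh i.
Qed.

End Rearrangement.

Lemma mem_rcoset_level_edges (R : realDomainType) (n : nat) (c : 'I_n.+1 -> R)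
    (a s : 'S_n.+1) :
  (forall i j : 'I_n.+1, (i <= j)%N -> (c (a i) <= c (a j))%R) ->
  s \in (T (level_edges (c \o a)) :* a)%g <-> rearr_sum c s = rearr_sum c a.
Proof.
move=> ah; rewrite mem_rcoset (T_level_edges (g := c \o a)) //.
split=> [/level_stabP st|sa].
  by apply: eq_bigr => i _; have /= := st i; rewrite permM permKV => ->.
apply/level_stabP => i; rewrite /= permM permKV.
apply: (homo_rearr_eq _ ah i); apply: rearr_sum_max_homo => t.
by rewrite sa; exact: (homo_rearr_sum_max t ah).
Qed.

(** * Faces of the permutahedron and their vertex sets *)

Section PermutahedronFaces.
Local Open Scope ring_scope.
Local Open Scope classical_set_scope.
Variables (R : realType) (n : nat).
Local Notation P := (@permutahedron R n).

Definition dot (c x : 'rV[R]_n.+1) : R := \sum_(i < n.+1) c 0 i * x 0 i.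

(* Inverting [s] turns the right cosets [T K :* a], on which the
   graphicahedron is built, into the left cosets of positions. *)
Definition vertex (s : 'S_n.+1) : 'rV[R]_n.+1 :=
  col_perm s^-1%g (\row_i i.+1%:R).

Lemma dot_vertex c s : dot c (vertex s) = rearr_sum (c 0) s.
Proof.
rewrite /dot (reindex_inj (@perm_inj _ s)); apply: eq_bigr => i _.
by rewrite !mxE permK.
Qed.

Lemma permutahedron_vertex s : P (vertex s).
Proof. by move=> A [_]; apply; exists s^-1%g. Qed.

(** A closed half-space is convex, so it contains the hull as soon as it contains the generating
    points. *)
Lemma permutahedron_le c b :
  (forall s, dot c (vertex s) <= b) -> forall x, P x -> dot c x <= b.
Proof.
move=> cb; apply: (@smallest_sub _ _ _ [set x | dot c x <= b])
  => [x y l|_ [s ->]]; last first.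
  by have := cb s^-1%g; rewrite /vertex invgK.
rewrite !inE /= => xb yb; set z := (X in dot c X).
have zE :
  z = l%:num *: (x : 'rV[R]_n.+1) + (1 - l%:num) *: (y : 'rV[R]_n.+1) by [].
have -> : dot c z = l%:num * dot c x + (1 - l%:num) * dot c y.
  rewrite zE /dot !mulr_sumr -big_split; apply: eq_bigr => i _ /=.
  by rewrite !mxE /=; ring.
have l0 : 0 <= l%:num by [].
have l1 : 0 <= 1 - l%:num by rewrite subr_ge0.
have -> : b = l%:num * b + (1 - l%:num) * b by ring.
by rewrite lerD // ler_wpM2l.
Qed.

(** No point is decomposed into vertices: for large [M] the slack of [c'] is at most [M] times the
    slack of [c] at every vertex, hence on all of [P]. On [F] the latter slack is zero, so the
    former is too. *)
Lemma is_face_subset F F' : is_face P F -> is_face P F' ->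
  (forall s, F (vertex s) -> F' (vertex s)) -> F `<=` F'.
Proof.
move=> [c [b [cb FE]]] [c' [b' [cb' FE']]] FF'.
(* The factor needed at a single vertex; the sum of these nonnegative factors serves all vertices.
   On vertices of [F] the division by zero gives 0, which is harmless since both slacks vanish
   there. *)
pose ratio s := (b' - dot c' (vertex s)) / (b - dot c (vertex s)).
pose M := \sum_s ratio s.
have ratio_ge0 s : 0 <= ratio s.
  rewrite divr_ge0 // subr_ge0; [apply: cb'|apply: cb];
    exact: permutahedron_vertex.
have dotM x : dot (M *: c - c') x = M * dot c x - dot c' x.
  by rewrite /dot mulr_sumr -sumrB; apply: eq_bigr => i _; rewrite !mxE; ring.
(* The half-space [b' - c'.x <= M (b - c.x)] contains all vertices. *)
have key s : dot (M *: c - c') (vertex s) <= M * b - b'.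
  rewrite dotM.
  suff: b' - dot c' (vertex s) <= M * (b - dot c (vertex s)) by lra.
  have := cb _ (permutahedron_vertex s).
  rewrite -/(dot _ _) le_eqVlt => /orP[/eqP sb|sb].
    have : F' (vertex s).
      by apply: FF'; rewrite FE; split=> //; exact: permutahedron_vertex.
    by rewrite FE' => -[_ /=]; rewrite -/(dot _ _) sb => ->; lra.
  rewrite -ler_pdivrMr ?subr_gt0 // -/(ratio s) /M (bigD1 s) //= lerDl.
  exact: sumr_ge0.
move=> x; rewrite FE => -[Px /= xb]; rewrite FE'; split=> //=.
have := permutahedron_le key Px; have := cb' _ Px.
rewrite dotM -/(dot c' x) {2}/dot xb => h1 h2.
by apply/eqP; rewrite eq_le h1 /=; lra.
Qed.

Lemma is_face_coset (K : {set edge (path_graph n)}) (a : 'S_n.+1) :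
  exists F, is_face P F /\ forall s, F (vertex s) <-> s \in (T K :* a)%g.
Proof.
(* Chosen so that [c \o a] is [cuts K]: it is nondecreasing, which makes [a] a maximiser, and it is
   constant exactly on the edges of [K]. *)
pose c : 'rV[R]_n.+1 := \row_i (cuts K (a^-1%g i))%:R.
have cE i : c 0 (a i) = (cuts K i)%:R by rewrite mxE permK.
have ch (i j : 'I_n.+1) : (i <= j)%N -> c 0 (a i) <= c 0 (a j).
  by move=> ij; rewrite !cE ler_nat cuts_homo.
have KE : level_edges (c 0 \o a) = K.
  rewrite -[RHS]cuts_level_edges; apply/setP => e.
  have [i [j [_ eE]]] := path_edgeP e.
  by rewrite !(level_edgesP _ eE) /= !cE eqr_nat.
exists (P `&` [set x | dot c x = rearr_sum (c 0) a]); split=> [|s].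
  exists c, (rearr_sum (c 0) a); split=> //.
  apply: permutahedron_le => s; rewrite dot_vertex.
  exact: homo_rearr_sum_max.
rewrite -KE mem_rcoset_level_edges //= dot_vertex.
by split=> [[]|] //; split=> //; exact: permutahedron_vertex.
Qed.

Lemma is_face_set0 : is_face P set0.
Proof.
exists 0, 1; split=> [x _|].
  by rewrite big1 ?ler01 // => i _; rewrite mxE mul0r.
apply/seteqP; split=> // x [_ /=].
rewrite big1 => [/eqP|i _]; last by rewrite mxE mul0r.
by rewrite eq_sym oner_eq0.
Qed.

(** If [F] contains a vertex [a], then [b] is the maximum of the functional over the vertices, so
    [a] is a maximiser and the equality case describes all the others. *)
Lemma is_face_vertices F : is_face P F ->
  (forall s, ~ F (vertex s)) \/
  exists (K : {set edge (path_graph n)}) a,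
    forall s, F (vertex s) <-> s \in (T K :* a)%g.
Proof.
move=> [c [b [cb FE]]].
have FvE s : F (vertex s) <-> rearr_sum (c 0) s = b.
  rewrite FE /= -/(dot _ _) dot_vertex.
  by split=> [[]|] //; split=> //; exact: permutahedron_vertex.
have [[a Fa]|nF] := pselect (exists s, F (vertex s)); last first.
  by left=> s Fs; apply: nF; exists s.
right; exists (level_edges (c 0 \o a)), a => s.
have ab := (FvE a).1 Fa.
rewrite mem_rcoset_level_edges ?ab //.
apply: rearr_sum_max_homo => t; rewrite ab -dot_vertex.
by apply: cb; exact: permutahedron_vertex.
Qed.

End PermutahedronFaces.

(** * Matching classes with faces through their vertex sets *)

Section Isomorphism.
Variable n : nat.
Local Notation G := (path_graph n).

(** Indexes the vertices of the face assigned to [x]; the adjoined least element goes with the empty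
    face. *)
Definition coset_of_gclass (x : graphicahedron G) : {set 'S_n.+1} :=
  if x is Some q then (T (repr q).1 :* (repr q).2)%g else finset.set0.

Lemma coset_of_gclass_pi (K : {set edge G}) (a : 'S_n.+1) :
  coset_of_gclass (Some (\pi_(gclass G) (K, a))%qT) = (T K :* a)%g.
Proof.
have : gsim (repr (\pi_(gclass G) (K, a))%qT) (K, a).
  by apply/eqmodP; rewrite reprK.
by move=> /andP[_ /eqP].
Qed.

Lemma coset_of_gclass_subset (x y : graphicahedron G) :
  (coset_of_gclass x \subset coset_of_gclass y) = (x <= y)%O.
Proof.
rewrite -[RHS]/(graphicahedron_le x y); case: x y => [x|] [y|] /=; last 2 first.
- by rewrite finset.sub0set.
- by rewrite finset.sub0set.
- rewrite -[x in RHS]reprK -[y in RHS]reprK gclass_leE /gpair_le.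
  by apply/idP/andP => [sub|[]//]; split=> //; apply: rcoset_T_subset sub.
- apply/negP => /fintype.subsetP/(_ (repr x).2); rewrite rcoset_refl inE.
  by move=> /(_ isT).
Qed.

End Isomorphism.

Theorem theorem4 (R : realType) (n : nat) :
  poset_isomorphic (graphicahedron (path_graph n))
                   (face_lattice (@permutahedron R n)).
Proof.
pose spec (x : graphicahedron (path_graph n))
    (F : face_lattice (@permutahedron R n)) :=
  forall s, face_set F (vertex R s) <-> s \in coset_of_gclass x.
have face_ex F : is_face (@permutahedron R n) F ->
    exists F' : face_lattice (@permutahedron R n), face_set F' = F.
  by move=> FP; have FP' := mem_set FP; exists (Face FP').
have /boolp.choice[f fP] : forall x, exists F, spec x F.
  move=> [q|].
    have [F [/face_ex[F' <-] FE]] := is_face_coset R (repr q).1 (repr q).2.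
    by exists F'.
  have [F' FE] := face_ex _ (is_face_set0 R n).
  by exists F' => s; rewrite FE inE.
(* Stated for the relation and not for a map, so that it yields both the order embedding and the two
   inverse laws. *)
have spec_le x y F F' : spec x F -> spec y F' -> (F <= F')%O = (x <= y)%O.
  move=> xF yF'; rewrite -coset_of_gclass_subset.
  apply/idP/fintype.subsetP => [/face_lattice_leE FF' s /xF /FF' /yF' //|sub].
  apply/face_lattice_leE; apply: is_face_subset; try exact: face_latticeP.
  by move=> s /xF /sub /yF'.
have /boolp.choice[g gP] : forall F, exists x, spec x F.
  move=> F; have [nF|[K [a FE]]] := is_face_vertices (face_latticeP F).
    by exists None => s; split=> [/nF//|]; rewrite finset.in_set0.
  exists (Some (\pi_(gclass _) (K, a))%qT) => s.
  by rewrite coset_of_gclass_pi; exact: FE.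
exists f; split; last by move=> x y; exact: spec_le.
(* [x] and [g (f x)] are related to the same face [f x], so reflexivity there gives both
   inequalities; symmetrically, [F] and [f (g F)] are related to [g F]. *)
exists g => [x|F]; apply: le_anti.
  rewrite -(spec_le _ _ _ _ (gP (f x)) (fP x)).
  by rewrite -(spec_le _ _ _ _ (fP x) (gP (f x))) !lexx.
rewrite (spec_le _ _ _ _ (fP (g F)) (gP F)).
by rewrite (spec_le _ _ _ _ (gP F) (fP (g F))) !lexx.
Qed.
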